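(* (1) Let $(W,\le,P,Q)$ be a $PQ$-frame such that for all $x,y,z\in W$: ($x\le y$ and $xPz$ imply $xQy$) and ($x\le y$ and $xQz$ imply $xPy$). If we define $$xRyz\iff (xPy\text{ and }x\le z)\text{ or }(x\le y\text{ and }xQz),$$ then $(W,\le,R)$ is a Birkhoff frame, and $P,Q$ are obtained from $R$ via $xPy\iff\exists w(xRyw)$ and $xQy\iff\exists w(xRwy)$. (2) Let $(W,\le,R)$ be a Birkhoff frame that satisfies, for all $x,y,z\in W$, $$xRyz\iff(\exists w(xRyw)\text{ and }x\le z)\text{ or }(x\le y\text{ and }\exists w(xRwz)),$$ and define $xPy\iff\exists w(xRyw)$ and $xQy\iff\exists w(xRwy)$. Then $(W,\le,P,Q)$ is a $PQ$-frame in which, for all $x,y,z\in W$, ($x\le y$ and $xPz$ imply $xQy$) and ($x\le y$ and $xQz$ imply $xPy$) hold.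
   Context: A $PQ$-frame is a structure $(W,\le,P,Q)$ where $(W,\le)$ is a poset and $P,Q\subseteq W^2$ are weakening relations, i.e., $u\le x$, $xPy$, $y\le v$ imply $uPv$, and $u\le x$, $xQy$, $y\le v$ imply $uQv$. A Birkhoff frame is a triple $(W,\le,R)$ where $(W,\le)$ is a poset and $R\subseteq W^3$ (written $xRyz$ for $(x,y,z)\in R$) satisfies: (R1) $u\le x$ and $xRyz$ imply $uRyz$; (R2) $xRyz$ and $y\le v$ imply $xRvz$; (R3) $xRyz$ and $z\le w$ imply $xRyw$. *)

(* Defs.v *)
From Stdlib Require Import Relations.

Set Implicit Arguments.
Unset Strict Implicit.

Definition weakening_relation (W : Type) (le S : relation W) : Prop :=
  forall u x y v, le u x -> S x y -> le y v -> S u v.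

Record PQ_frame (W : Type) (le P Q : relation W) : Prop := {
  PQ_frame_poset : order W le;
  PQ_frame_P : weakening_relation le P;
  PQ_frame_Q : weakening_relation le Q
}.

(* [R x y z] stands for the infix notation x R y z. *)
Record Birkhoff_frame (W : Type) (le : relation W) (R : W -> W -> W -> Prop)
    : Prop := {
  Birkhoff_frame_poset : order W le;
  Birkhoff_frame_R1 : forall u x y z, le u x -> R x y z -> R u y z;
  Birkhoff_frame_R2 : forall x y z v, R x y z -> le y v -> R x v z;
  Birkhoff_frame_R3 : forall x y z w, R x y z -> le z w -> R x y w
}.

Definition R_of_PQ (W : Type) (le P Q : relation W) (x y z : W) : Prop :=
  (P x y /\ le x z) \/ (le x y /\ Q x z).

Definition P_of_R (W : Type) (R : W -> W -> W -> Prop) (x y : W) : Prop :=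
  exists w, R x y w.

Definition Q_of_R (W : Type) (R : W -> W -> W -> Prop) (x y : W) : Prop :=
  exists w, R x w y.

(* Main.v *)
Require Import Defs.
From Stdlib Require Import Relations.

(** Each disjunct of [R_of_PQ] pairs one of [P], [Q] with an inequality, so R1-R3 reduce to
    weakening and transitivity. Projecting [R] returns the intended relation from one disjunct; the
    exchange conditions convert the other. Conversely, projections of a Birkhoff relation inherit
    weakening, and the fixed-point equation for [R] yields the exchange conditions. *)

Theorem theorem4p5 :
  (forall (W : Type) (le P Q : relation W),
     PQ_frame le P Q ->
     (forall x y z : W,
        (le x y /\ P x z -> Q x y) /\ (le x y /\ Q x z -> P x y)) ->
     Birkhoff_frame le (R_of_PQ le P Q) /\
     (forall x y : W, P x y <-> P_of_R (R_of_PQ le P Q) x y) /\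
     (forall x y : W, Q x y <-> Q_of_R (R_of_PQ le P Q) x y))
  /\
  (forall (W : Type) (le : relation W) (R : W -> W -> W -> Prop),
     Birkhoff_frame le R ->
     (forall x y z : W,
        R x y z <->
        ((exists w, R x y w) /\ le x z) \/ (le x y /\ (exists w, R x w z))) ->
     PQ_frame le (P_of_R R) (Q_of_R R) /\
     (forall x y z : W,
        (le x y /\ P_of_R R x z -> Q_of_R R x y) /\
        (le x y /\ Q_of_R R x z -> P_of_R R x y))).
Proof.
split.
- intros W le P Q [[refl trans anti] wP wQ] H.
  split; [split|split].
  + split; assumption.
  + intros u x y z ux [[Pxy xz]|[xy Qxz]]; [left|right]; eauto.
  + intros x y z v [[Pxy xz]|[xy Qxz]] yv; [left|right]; eauto.
  + intros x y z w [[Pxy xz]|[xy Qxz]] zw; [left|right]; eauto.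
  + intros x y; split.
    (* Reflexivity makes [x] itself a witness. *)
    * intros Pxy; exists x; left; auto.
    * intros [w [[Pxy _]|[xy Qxw]]]; [exact Pxy|].
      (* The wrong disjunct: [le x y] and [Q x w] exchange to [P x y]. *)
      apply (H x y w); auto.
  + intros x y; split.
    * intros Qxy; exists x; right; auto.
    * intros [w [[Pxw xy]|[_ Qxy]]]; [|exact Qxy].
      apply (H x y w); auto.
- intros W le R [po R1 R2 R3] H.
  split; [split|].
  + exact po.
  (* The witness is kept; R1 lowers [x] and R2 raises [y]. *)
  + intros u x y v ux [w Rxyw] yv; exists w; eauto.
  + intros u x y v ux [w Rxwy] yv; exists w; eauto.
  (* The witness [z] gives [R x z y] by the left disjunct of [H], and [R x y z] by the right one. *)
  + intros x y z; split; intros [xy xz]; exists z; apply H; auto.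
Qed.
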